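(* Let $\lambda\ge0$, suppose $\rho^2(A)(1-r_s)<1$, and let $Q$ be the $Q$-factor of the costly communication problem. Then for all $\tau,\tau'\in\mathbb S$ with $\tau\ge\tau'$ and all $a,a'\in\mathbb A$ with $a\ge a'$, $$Q(\tau,a)-Q(\tau,a')\le Q(\tau',a)-Q(\tau',a').$$
   Context: System data: matrices $A,C,\Sigma_w,\Sigma_v$ with $\Sigma_w$ positive semidefinite, $\Sigma_v$ positive definite, $(A,C)$ detectable, $(A,\sqrt{\Sigma_w})$ stabilizable. $\rho(A)$ is the spectral radius. $\overline P$ is the steady-state (filtered) Kalman error covariance: $\overline P=S-SC^\top(CSC^\top+\Sigma_v)^{-1}CS$, where $S$ is the unique positive semidefinite solution of $S=ASA^\top+\Sigma_w-ASC^\top(CSC^\top+\Sigma_v)^{-1}CSA^\top$. Put $P(0)=\overline P$ and $P(\tau)=A^\tau\overline P(A^\top)^\tau+\sum_{t=0}^{\tau-1}A^t\Sigma_w(A^\top)^t$ for $\tau\ge1$. Markov decision process: states $\mathbb S=\mathbb N=\{0,1,2,\dots\}$, actions $\mathbb A=\{0,1\}$, one-stage cost $c(\tau,a)=\operatorname{Tr}P(\tau)+\lambda a$, transitions (with $r_s\in(0,1]$): $\Pr(0\mid\tau,1)=r_s$, $\Pr(\tau+1\mid\tau,1)=1-r_s$, $\Pr(\tau+1\mid\tau,0)=1$, all others $0$. $\mathcal J^\star=\inf_f\limsup_{T\to\infty}\frac1{T+1}\mathbb E[\sum_{k=0}^Tc(\tau(k),a(k))\mid\tau(0)=0]$ is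 the optimal average cost over Markovian policies $a(k)=f_k(\tau(k))$. The relative value function $V:\mathbb S\to\mathbb R$ is a bounded-below solution of the Bellman optimality equation $V(\tau)=\min_{a\in\mathbb A}[c(\tau,a)+\sum_{\tau_+}V(\tau_+)\Pr(\tau_+\mid\tau,a)-\mathcal J^\star]$, $\tau\in\mathbb S$. The $Q$-factor is $Q(\tau,a)=c(\tau,a)+\sum_{\tau'}V(\tau')\Pr(\tau'\mid\tau,a)-\mathcal J^\star$, so that $V(\tau)=\min_{a\in\mathbb A}Q(\tau,a)$. *)

(* Defs.v *)
From mathcomp Require Export all_boot all_order all_algebra.
From mathcomp Require Export all_classical all_reals all_analysis.
From mathcomp Require Export complex.

Set Implicit Arguments.
Unset Strict Implicit.
Unset Printing Implicit Defensive.

Import Order.TTheory GRing.Theory Num.Theory.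
Import numFieldTopology.Exports numFieldNormedType.Exports.

Local Open Scope classical_set_scope.
Local Open Scope ring_scope.

Section Matrices.
Context {R : realType}.

Definition psd n (M : 'M[R]_n) : Prop :=
  M^T = M /\ forall x : 'cV[R]_n, 0 <= (x^T *m M *m x) 0 0.

Definition posdef n (M : 'M[R]_n) : Prop :=
  M^T = M /\ forall x : 'cV[R]_n, x != 0 -> 0 < (x^T *m M *m x) 0 0.

(* The matrix square root: the (unique) positive semidefinite one. *)
Definition is_sqrtmx n (M W : 'M[R]_n) : Prop := psd W /\ W *m W = M.

(* Largest modulus of a complex eigenvalue; [sup set0 = 0] covers n = 0. *)
Definition spectral_radius n (M : 'M[R]_n) : R :=
  sup [set ComplexField.Normc.normc z
      | z in [set z : R[i] | eigenvalue (map_mx (real_complex R) M) z]].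

Definition detectable n m (A : 'M[R]_n) (C : 'M[R]_(m, n)) : Prop :=
  exists L : 'M[R]_(n, m), spectral_radius (A - L *m C) < 1.

Definition stabilizable n m (A : 'M[R]_n) (B : 'M[R]_(n, m)) : Prop :=
  exists K : 'M[R]_(m, n), spectral_radius (A - B *m K) < 1.

End Matrices.

Section Kalman.
Context {R : realType} {n m : nat}.
Variables (A : 'M[R]_n) (C : 'M[R]_(m, n)) (Sw : 'M[R]_n) (Sv : 'M[R]_m).

(* [C S C^T + Sv] is positive definite whenever S is positive semidefinite and
   Sv positive definite, so [invmx] is then a genuine inverse. *)
Definition dare_solution (S : 'M[R]_n) : Prop :=
  psd S /\
  S = A *m S *m A^T + Sw
      - A *m S *m C^T *m invmx (C *m S *m C^T + Sv) *m C *m S *m A^T.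

Definition filtered_cov (S : 'M[R]_n) : 'M[R]_n :=
  S - S *m C^T *m invmx (C *m S *m C^T + Sv) *m C *m S.

(* The error covariance P(tau) with P(0) = Pbar (empty sum at tau = 0). *)
Definition error_cov (Pbar : 'M[R]_n) (tau : nat) : 'M[R]_n :=
  A ^+ tau *m Pbar *m (A^T) ^+ tau
  + \sum_(0 <= t < tau) (A ^+ t *m Sw *m (A^T) ^+ t).

(* The action 0 is [false] and the action 1 is [true]. *)
Definition stage_cost (Pbar : 'M[R]_n) (lambda : R) (tau : nat) (a : bool) : R :=
  \tr (error_cov Pbar tau) + lambda * a%:R.

End Kalman.

Section MDP.
Context {R : realType}.
Variables (c : nat -> bool -> R) (rs : R).

Definition trans (tau : nat) (a : bool) (tau' : nat) : R :=
  if a then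
    if tau' == 0%N then rs else if tau' == tau.+1 then 1 - rs else 0
  else
    if tau' == tau.+1 then 1 else 0.

(* Probability that (tau(0), ..., tau(T)) = h when tau(0) = 0 and
   a(k) = f k (tau(k)). *)
Definition path_prob (f : nat -> nat -> bool) (T : nat) (h : T.+1.-tuple nat) : R :=
  (nth 0%N h 0 == 0%N)%:R
  * \prod_(0 <= k < T) trans (nth 0%N h k) (f k (nth 0%N h k)) (nth 0%N h k.+1).

(* E[sum_(k <= T) c(tau(k), a(k)) | tau(0) = 0]. [esum] is a supremum of finite
   partial sums, so this is the expectation for nonnegative c only. *)
Definition expected_cost (f : nat -> nat -> bool) (T : nat) : \bar R :=
  (\esum_(h in [set: T.+1.-tuple nat])
     (path_prob f h
      * \sum_(0 <= k < T.+1) c (nth 0%N h k) (f k (nth 0%N h k)))%:E)%E.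

Definition average_cost (f : nat -> nat -> bool) : \bar R :=
  limn_esup (fun T : nat => ((T.+1%:R^-1 : R)%:E * expected_cost f T)%E).

(* Infimum over deterministic, possibly time-varying, Markovian policies. *)
Definition optimal_cost : \bar R := ereal_inf (range average_cost).

(* The sum over successor states has at most two nonzero terms. The optimal
   average cost is read as a real number, as it is finite in the setting where
   this is used. *)
Definition Qfactor (V : nat -> R) (tau : nat) (a : bool) : R :=
  c tau a + limn (series (fun tau' => V tau' * trans tau a tau'))
  - fine optimal_cost.

Definition relative_value_function (V : nat -> R) : Prop :=
  (exists b : R, forall tau, b <= V tau) /\
  (forall tau, V tau = Num.min (Qfactor V tau false) (Qfactor V tau true)).

End MDP.

(* Main.v *)
(** Since Q(t,1) - Q(t,0) = lambda + rs (V(0) - V(t+1)), submodularity amounts to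
    monotonicity of V on positive states.  The Bellman equation has the form
    V(t) = g(t) + phi(V(t+1)) with phi(x) = min(x, K + (1 - rs) x) nondecreasing
    and nonexpansive, and g is nondecreasing because the Kalman correction
    decreases the covariance.  A drop V(t) - V(t+1) > 0 would then propagate to
    all later states without shrinking, so V would tend to -oo. *)

Require Import Defs.
From mathcomp Require Import lra.

Set Implicit Arguments.
Unset Strict Implicit.
Unset Printing Implicit Defensive.

Import Order.TTheory GRing.Theory Num.Theory.
Import numFieldNormedType.Exports.
Local Open Scope ring_scope.

Section PositiveSemidefinite.
Context {R : realType}.

Lemma psdD n (M N : 'M[R]_n) : psd M -> psd N -> psd (M + N).
Proof.
move=> [Mt M0] [Nt N0]; split; first by rewrite linearD /= Mt Nt.
by move=> x; rewrite mulmxDr mulmxDl mxE addr_ge0.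
Qed.

Lemma psd_congr n k (B : 'M[R]_(k, n)) (M : 'M[R]_n) :
  psd M -> psd (B *m M *m B^T).
Proof.
move=> [Mt M0]; split; first by rewrite !trmx_mul trmxK Mt mulmxA.
by move=> x; have := M0 (B^T *m x); rewrite trmx_mul trmxK !mulmxA.
Qed.

Lemma posdef_psd n (M : 'M[R]_n) : posdef M -> psd M.
Proof.
move=> [Mt M0]; split=> // x; have [->|/M0/ltW //] := eqVneq x 0.
by rewrite mulmx0 mxE.
Qed.

(* The singular case holds through the junk value [invmx M = M]. *)
Lemma psd_invmx n (M : 'M[R]_n) : psd M -> psd (invmx M).
Proof.
move=> psdM; have [Mu|/negbTE Mu] := boolP (M \in unitmx); last first.
  by rewrite /invmx Mu.
have It : (invmx M)^T = invmx M by rewrite trmx_inv psdM.1.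
by have := psd_congr (invmx M) psdM; rewrite It mulVmx // mul1mx.
Qed.

Lemma psd_mxtrace_ge0 n (M : 'M[R]_n) : psd M -> 0 <= \tr M.
Proof.
move=> [_ M0]; apply: sumr_ge0 => i _.
(* Testing the quadratic form on the [i]-th basis vector yields the diagonal entry [M i i]. *)
have := M0 (delta_mx i 0).
by rewrite trmx_delta -rowE -colE !mxE.
Qed.

End PositiveSemidefinite.

Section ErrorCovariance.
Context {R : realType} {n m : nat}.
Variables (A : 'M[R]_n) (C : 'M[R]_(m, n)) (Sw : 'M[R]_n) (Sv : 'M[R]_m).
Variable S : 'M[R]_n.

Lemma trmx_exp (k : nat) : A^T ^+ k = (A ^+ k)^T.
Proof.
elim: k => [|k IH]; first by rewrite !expr0 trmx1.
by rewrite exprS exprSr IH -!mulmxE trmx_mul.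
Qed.

(** Every increment is a congruence of the one at [tau = 0], so only the sign of that single matrix
    matters. *)
Lemma error_covS Pbar tau :
  error_cov A Sw Pbar tau.+1 - error_cov A Sw Pbar tau
  = A ^+ tau *m (A *m Pbar *m A^T + Sw - Pbar) *m (A ^+ tau)^T.
Proof.
rewrite /error_cov big_nat_recr //= exprSr exprS trmx_exp -!mulmxE.
rewrite !(mulmxDr, mulmxDl) mulmxN mulNmx !mulmxA.
by rewrite [X in _ + X - _]addrC addrA [X in _ - X]addrC addrKA.
Qed.

Lemma error_cov_trace_nondecreasing : psd Sv -> dare_solution A C Sw Sv S ->
  {homo (fun tau => \tr (error_cov A Sw (filtered_cov C Sv S) tau))
     : s t / (s <= t)%N >-> s <= t}.
Proof.
move=> psdSv [psdS dareS]; apply: homo_leq => // [|tau].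
  exact: le_trans.
rewrite -subr_ge0 -raddfB /= error_covS.
(* The Riccati equation says that predicting one step from the filtered covariance gives back
   [S]. *)
have -> : A *m filtered_cov C Sv S *m A^T + Sw = S.
  rewrite {2}dareS /filtered_cov mulmxBr mulmxBl !mulmxA.
  by rewrite addrAC.
apply: psd_mxtrace_ge0; apply: psd_congr.
(* What remains is the Kalman correction, a congruence by [S *m C^T] of the inverse innovation
   covariance. *)
rewrite /filtered_cov opprB addrC subrK.
have := psd_congr (S *m C^T) (psd_invmx (psdD (psd_congr C psdS) psdSv)).
by rewrite trmx_mul trmxK psdS.1 !mulmxA.
Qed.

End ErrorCovariance.

Section Bellman.
Context {R : realType}.

Lemma limn_series_finite_support (u : nat -> R) (N : nat) :
  (forall k, (N <= k)%N -> u k = 0) ->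
  limn (series u) = \sum_(0 <= k < N) u k.
Proof.
move=> u0; apply: cvg_lim => //.
apply: cvg_near_cst; exists N => // k /= Nk.
rewrite /series /= (@big_cat_nat _ _ _ N) //=.
rewrite [X in _ + X]big_nat_cond [X in _ + X]big1 ?addr0 //.
by move=> i /andP[/andP[/u0]].
Qed.

Variables (c : nat -> bool -> R) (rs : R) (V : nat -> R).

Lemma Qfactor_false tau :
  Qfactor c rs V tau false = c tau false + V tau.+1 - fine (optimal_cost c rs).
Proof.
(* The cutoff [tau.+2] is one past the only successor, [tau.+1]. *)
rewrite /Qfactor (@limn_series_finite_support _ tau.+2) => [|k tk]; last first.
  by rewrite /trans gtn_eqF // mulr0.
rewrite big_nat_recr //= /trans eqxx mulr1 big_nat_cond big1 ?add0r //.
by move=> i /andP[/andP[_ it] _]; rewrite ltn_eqF // mulr0.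
Qed.

Lemma Qfactor_true tau :
  Qfactor c rs V tau true
  = c tau true + (rs * V 0%N + (1 - rs) * V tau.+1) - fine (optimal_cost c rs).
Proof.
rewrite /Qfactor (@limn_series_finite_support _ tau.+2) => [|k tk]; last first.
  by rewrite /trans gtn_eqF ?(leq_trans _ tk) // gtn_eqF // mulr0.
(* The last term is the move to [tau.+1], the first is the reset to 0; all terms between vanish. *)
rewrite big_nat_recr //= big_nat_recl //= /trans eqxx /=.
rewrite big_nat_cond big1 ?addr0; last first.
  by move=> i /andP[/andP[_ it] _]; rewrite ltn_eqF // mulr0.
by rewrite ![V _ * _]mulrC.
Qed.

End Bellman.

Lemma nonexpansive_recursion_nondecreasing (R : realType)
    (phi : R -> R) (g V : nat -> R) (b : R) :
  {homo phi : x y / x <= y} ->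
  (forall x y, y <= x -> phi x - phi y <= x - y) ->
  {homo g : s t / (s <= t)%N >-> s <= t} ->
  (forall t, V t = g t + phi (V t.+1)) ->
  (forall t, b <= V t) ->
  {homo V : s t / (s <= t)%N >-> s <= t}.
Proof.
move=> phi_homo phi_nonexp g_homo Vrec Vb.
apply: homo_leq => // [|t]; first exact: le_trans.
rewrite leNgt; apply/negP => drop.
set d := V t - V t.+1; have d0 : 0 < d by rewrite subr_gt0.
have step k : d <= V (t + k)%N - V (t + k).+1.
  elim: k => [|k IH]; first by rewrite addn0.
  rewrite addnS; set s := (t + k)%N in IH *.
  have gs : g s <= g s.+1 by apply: g_homo.
  have Vs := Vrec s; have Vs1 := Vrec s.+1.
  (* Without a drop at [s.+1], monotonicity of [phi] and [g] would exclude the drop at [s]. With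
     one, nonexpansiveness makes it at least as large as the drop at [s]. *)
  have [le|lt] := leP (V s.+1) (V s.+2).
    have := phi_homo _ _ le; lra.
  have := phi_nonexp _ _ (ltW lt); lra.
have fall k : V (t + k)%N <= V t - d *+ k.
  elim: k => [|k IH]; first by rewrite addn0 mulr0n subr0.
  have := step k; rewrite addnS mulrSr; lra.
have [k] : exists k : nat, V t - b < d *+ k.
  (* By the Archimedean property, this many drops of size [d] take [V] from [V t] below its bound
     [b]. *)
  exists (Num.bound ((V t - b) / d)).
  rewrite -mulr_natr mulrC -ltr_pdivrMr //.
  apply: le_lt_trans (archi_boundP _); rewrite ?ler_norm //.
  by rewrite divr_ge0 ?subr_ge0 // ltW.
have := fall k; have := Vb (t + k)%N; lra.
Qed.

Theorem lemma4 (R : realType) (n m : nat)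
  (A : 'M[R]_n) (C : 'M[R]_(m, n)) (Sw : 'M[R]_n) (Sv : 'M[R]_m)
  (hSw : psd Sw) (hSv : posdef Sv)
  (hdet : detectable A C)
  (sqrtSw : 'M[R]_n) (hsqrt : is_sqrtmx Sw sqrtSw)
  (hstab : stabilizable A sqrtSw)
  (S : 'M[R]_n) (hS : dare_solution A C Sw Sv S)
  (lambda rs : R) (hlambda : 0 <= lambda) (hrs0 : 0 < rs) (hrs1 : rs <= 1)
  (hrho : spectral_radius A ^+ 2 * (1 - rs) < 1)
  (V : nat -> R)
  (hV : relative_value_function
          (stage_cost A Sw (filtered_cov C Sv S) lambda) rs V) :
  let Q := Qfactor (stage_cost A Sw (filtered_cov C Sv S) lambda) rs V in
  forall (tau tau' : nat) (a a' : bool),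
    (tau' <= tau)%N -> (a' <= a)%N ->
    Q tau a - Q tau a' <= Q tau' a - Q tau' a'.
Proof.
move=> Q tau tau' a a' le_tau le_a.
have [[b Vb] bellman] := hV.
pose p t := \tr (error_cov A Sw (filtered_cov C Sv S) t).
pose J := fine (optimal_cost (stage_cost A Sw (filtered_cov C Sv S) lambda) rs).
have Q0 t : Q t false = p t + V t.+1 - J.
  by rewrite /Q Qfactor_false /stage_cost mulr0 addr0.
have Q1 t : Q t true = p t + lambda + (rs * V 0%N + (1 - rs) * V t.+1) - J.
  by rewrite /Q Qfactor_true /stage_cost mulr1.
(* Both Q-factors share the summand [p t - J]; [phi] is the minimum of what is left, with [x]
   standing for [V t.+1]. Its two branches are affine with slopes 1 and [1 - rs], both in [0, 1]. *)
pose phi x := Num.min x (lambda + rs * V 0%N + (1 - rs) * x).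
have V_homo : {homo V : s t / (s <= t)%N >-> s <= t}.
  apply: (@nonexpansive_recursion_nondecreasing _ phi (fun t => p t - J) _ b) => //.
  - move=> x y xy; have : (1 - rs) * x <= (1 - rs) * y.
      by rewrite ler_wpM2l ?subr_ge0.
    rewrite /phi; case: (leP x (_ + _)); case: (leP y (_ + _)); lra.
  - move=> x y xy; have : rs * y <= rs * x by rewrite ler_wpM2l // ltW.
    rewrite /phi; case: (leP x (_ + _)); case: (leP y (_ + _)); lra.
  - move=> s t st; rewrite lerD2r.
    exact: (error_cov_trace_nondecreasing (posdef_psd hSv) hS).
  - move=> t; rewrite bellman -/(Q t false) -/(Q t true) Q0 Q1 /phi.
    by rewrite addr_minr; congr Num.min; lra.
(* Equal actions give 0 on both sides, which leaves [a = true] and [a' = false]. *)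
case: a a' le_a => [] [] // _; rewrite ?subrr //.
have : rs * V tau'.+1 <= rs * V tau.+1 by rewrite ler_wpM2l ?V_homo // ltW.
by rewrite !Q0 !Q1; lra.
Qed.
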